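(* Let $\mathbb{T}$ be a time scale, let $a,b\in\mathbb{T}$ with $a<b$, let $[a,b]$ denote the interval $\{t\in\mathbb{T}: a\le t\le b\}$ in $\mathbb{T}$, and let $0\le\alpha\le 1$. Let $c$ and $d$ be real numbers, and let $(c,d)$ denote the open interval of real numbers. Suppose that $g:[a,b]\rightarrow(c,d)$ is continuous and $F:(c,d)\rightarrow\mathbb{R}$ is convex. Then $$F\left(\frac{\int_a^b g(t)\,\Diamond_\alpha t}{b-a}\right)\leq\frac{\int_a^b F(g(t))\,\Diamond_\alpha t}{b-a}.$$
   Context: A time scale $\mathbb{T}$ is a nonempty closed subset of $\mathbb{R}$, with the topology induced from $\mathbb{R}$. The forward and backward jump operators $\sigma,\rho:\mathbb{T}\to\mathbb{T}$ are $\sigma(t)=\inf\{s\in\mathbb{T}: s>t\}$ and $\rho(t)=\sup\{s\in\mathbb{T}: s<t\}$, with the conventions $\inf\emptyset=\sup\mathbb{T}$ and $\sup\emptyset=\inf\mathbb{T}$. For $a<b$ in $\mathbb{T}$, $[a,b]$ denotes $\{t\in\mathbb{T}: a\le t\le b\}$. A function $H:[a,b]\to\mathbb{R}$ has delta derivative $H^\Delta(t)$ at $t\in[a,b]$, $t<b$, if for every $\varepsilon>0$ there is a neighborhood $U$ of $t$ in $[a,b]$ with $|H(\sigma(t))-H(s)-H^\Delta(t)(\sigma(t)-s)|\le\varepsilon|\sigma(t)-s|$ for all $s\in U$. It has nabla derivative $H^\nabla(t)$ at $t\in[a,b]$, $t>a$, if for every $\varepsilon>0$ there is a neighborhood $U$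 of $t$ in $[a,b]$ with $|H(\rho(t))-H(s)-H^\nabla(t)(\rho(t)-s)|\le\varepsilon|\rho(t)-s|$ for all $s\in U$. For continuous $f:[a,b]\to\mathbb{R}$, the delta integral is $\int_a^b f(t)\,\Delta t=H(b)-H(a)$, where $H$ is a delta antiderivative of $f$ (a continuous $H:[a,b]\to\mathbb{R}$ with $H^\Delta(t)=f(t)$ for all $t\in[a,b]$, $t<b$); the nabla integral is $\int_a^b f(t)\,\nabla t=G(b)-G(a)$, where $G$ is a nabla antiderivative of $f$ (a continuous $G:[a,b]\to\mathbb{R}$ with $G^\nabla(t)=f(t)$ for all $t\in[a,b]$, $t>a$). Both integrals exist and are well defined for continuous $f$. For $0\le\alpha\le1$, the diamond-$\alpha$ integral is $$\int_a^b f(t)\,\Diamond_\alpha t=\alpha\int_a^b f(t)\,\Delta t+(1-\alpha)\int_a^b f(t)\,\nabla t.$$ *)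

(* Defs.v *)
From HB Require Import structures.
From mathcomp Require Import all_boot all_order all_algebra.
From mathcomp Require Import all_classical all_reals all_analysis.

Set Implicit Arguments.
Unset Strict Implicit.
Unset Printing Implicit Defensive.

Import Order.TTheory GRing.Theory Num.Theory.
Import numFieldNormedType.Exports.

Local Open Scope classical_set_scope.
Local Open Scope ring_scope.

(* Functions on a subset of the line are represented by total functions
   R -> R; every notion below depends only on the values taken on that
   subset. *)

Definition time_scale (R : realType) (T : set R) : Prop :=
  T !=set0 /\ closed T.

Definition ts_interval (R : realType) (T : set R) (a b : R) : set R :=
  [set t | T t /\ a <= t <= b].

(* The library's [inf] and [sup] take a default value on the empty set, so
   the conventions inf set0 = sup T and sup set0 = inf T are made explicit. *)
Definition forward_jump (R : realType) (T : set R) (t : R) : R :=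
  let A := [set s | T s /\ t < s] in
  if pselect (A !=set0) then inf A else sup T.

Definition backward_jump (R : realType) (T : set R) (t : R) : R :=
  let A := [set s | T s /\ s < t] in
  if pselect (A !=set0) then sup A else inf T.

(* [within I (nbhs t)] is the filter of neighborhoods of t relative to I. *)
Definition is_delta_derivative (R : realType) (T : set R) (a b : R)
    (H : R -> R) (t D : R) : Prop :=
  forall e : R, 0 < e ->
    \forall s \near within (ts_interval T a b) (nbhs t),
      `|H (forward_jump T t) - H s - D * (forward_jump T t - s)|
        <= e * `|forward_jump T t - s|.

Definition is_nabla_derivative (R : realType) (T : set R) (a b : R)
    (H : R -> R) (t D : R) : Prop :=
  forall e : R, 0 < e ->
    \forall s \near within (ts_interval T a b) (nbhs t),
      `|H (backward_jump T t) - H s - D * (backward_jump T t - s)|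
        <= e * `|backward_jump T t - s|.

Definition delta_antiderivative (R : realType) (T : set R) (a b : R)
    (f H : R -> R) : Prop :=
  {within ts_interval T a b, continuous H} /\
  forall t, ts_interval T a b t -> t < b ->
    is_delta_derivative T a b H t (f t).

Definition nabla_antiderivative (R : realType) (T : set R) (a b : R)
    (f G : R -> R) : Prop :=
  {within ts_interval T a b, continuous G} /\
  forall t, ts_interval T a b t -> a < t ->
    is_nabla_derivative T a b G t (f t).

(* The default value 0 is returned only when f has no antiderivative, which
   does not happen for f continuous on the interval. *)
Definition delta_integral (R : realType) (T : set R) (a b : R)
    (f : R -> R) : R :=
  xget 0 [set I | exists2 H, delta_antiderivative T a b f H & I = H b - H a].

Definition nabla_integral (R : realType) (T : set R) (a b : R)
    (f : R -> R) : R :=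
  xget 0 [set I | exists2 G, nabla_antiderivative T a b f G & I = G b - G a].

Definition diamond_integral (R : realType) (T : set R) (alpha a b : R)
    (f : R -> R) : R :=
  alpha * delta_integral T a b f + (1 - alpha) * nabla_integral T a b f.

(* Main.v *)
Require Import Defs.
From HB Require Import structures.
From mathcomp Require Import all_boot all_order all_algebra.
From mathcomp Require Import all_classical all_reals all_analysis.
From mathcomp Require Import measurable_realfun ring lra.
Import Order.TTheory GRing.Theory Num.Theory.
Import numFieldNormedType.Exports.
Local Open Scope classical_set_scope.
Local Open Scope ring_scope.

(* The delta integral is monotone and affine on continuous functions: a
   nonnegative delta derivative forces H a <= H b, and a delta antiderivative
   of f is H t = \int_a^t f (l x) dx, the Lebesgue integral of the step
   function built from the last point l x <= x of the time scale. The nabla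
   integral is the delta integral over the reflected time scale -T, so the
   diamond integral is monotone and affine as well. A convex F on an open
   interval is continuous, so that the right-hand side is a genuine integral,
   and Jensen's inequality follows by integrating F (g t) >= F m + k (g t - m),
   where k is the slope of a supporting line of F at the mean m of g, which
   lies between the extrema of g, hence in ]c, d[. *)

(** * Epsilon-delta forms of relative neighborhoods and continuity *)

Lemma near_within_normP {R : realType} {A P : set R} {t : R} :
  (\forall s \near within A (nbhs t), P s) <->
  exists2 d : R, 0 < d & forall s, A s -> `|s - t| < d -> P s.
Proof.
rewrite near_withinE; split.
  move=> /nbhs_ballP[d d0 AP]; exists d => // s As std.
  by apply: AP => //; rewrite -ball_normE /ball_/= distrC.
move=> [d d0 AP]; apply/nbhs_ballP; exists d => // s.
by rewrite -ball_normE /ball_/= distrC => std As; exact: AP.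
Qed.

Lemma within_continuous_normP {R : realType} {A : set R} {f : R -> R} :
  {within A, continuous f} <->
  forall t, A t -> forall e : R, 0 < e ->
    exists2 d : R, 0 < d & forall s, A s -> `|s - t| < d -> `|f s - f t| < e.
Proof.
split.
  move=> /subspace_continuousP cf t At e e0.
  have /cvgrPdist_lt/(_ _ e0)/near_within_normP[d d0 fd] := cf t At.
  by exists d => // s As std; rewrite distrC; exact: fd.
move=> cf; apply/subspace_continuousP => t At.
apply/cvgrPdist_lt => e e0; apply/near_within_normP.
have [d d0 fd] := cf t At e e0.
by exists d => // s As std; rewrite distrC; exact: fd.
Qed.

(** * Suprema and infima in closed sets *)

Section closed_sets.
Context {R : realType} {A : set R}.
Hypothesis closedA : closed A.

Lemma closed_near_mem (x : R) :
  (forall e : R, 0 < e -> exists2 s, A s & `|s - x| < e) -> A x.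
Proof.
move=> nearx; apply: closedA => B /nbhs_ballP[e e0 xB].
have [s As sx] := nearx e e0; exists s; split=> //.
by apply: xB; rewrite -ball_normE /ball_/= distrC.
Qed.

Lemma closed_sup_mem {B : set R} : B `<=` A -> has_sup B -> A (sup B).
Proof.
move=> BA supB; apply: closed_near_mem => e e0.
have [s Bs es] := sup_adherent e0 supB.
exists s; first exact: BA.
have := sup_upper_bound supB Bs.
by rewrite ltr_distlC; lra.
Qed.

Lemma closed_inf_mem {B : set R} : B `<=` A -> has_inf B -> A (inf B).
Proof.
move=> BA infB; apply: closed_near_mem => e e0.
have [s Bs es] := inf_adherent e0 infB.
exists s; first exact: BA.
have := inf_lbound infB.2 Bs.
by rewrite ltr_distlC; lra.
Qed.

End closed_sets.

(** * Intervals of a time scale and induction along them *)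

Section time_scale_interval.
Context {R : realType} {T : set R} {a b : R}.
Hypotheses (closedT : closed T) (Ta : T a) (Tb : T b) (ltab : a < b).
Local Notation I := (ts_interval T a b).

Lemma ts_interval_left : I a.
Proof. by split=> //; rewrite lexx ltW. Qed.

Lemma ts_interval_right : I b.
Proof. by split=> //; rewrite lexx ltW. Qed.

Lemma ts_interval_setI : I = T `&` `[a, b].
Proof.
by apply/seteqP; split=> t [].
Qed.

Lemma ts_interval_closed : closed I.
Proof.
by rewrite ts_interval_setI; apply: closedI => //; exact: interval_closed.
Qed.

Lemma ts_interval_compact : compact I.
Proof.
apply: subclosed_compact ts_interval_closed (@segment_compact _ a b) _.
by rewrite ts_interval_setI; exact: subIsetr.
Qed.

(** The point [b] lies beyond [t], so the default for an empty set does not arise and the jump taken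
    in [T] stays in the interval. The last clause is right-density, as approximability from the
    right. *)
Lemma forward_jump_spec {t : R} : t < b ->
  let s := forward_jump T t in
  [/\ T s, t <= s <= b, forall u, T u -> t < u -> s <= u
    & s = t -> forall d : R, 0 < d -> exists2 u, T u & t < u < t + d].
Proof.
move=> tb; rewrite /forward_jump; case: pselect => [A0|[]]; last by exists b.
set A := [set _ | _] in A0 *.
have lbA : lbound A t by move=> u [_ /ltW].
have infA : has_inf A by split=> //; exists t.
have geA u : A u -> inf A <= u by exact: (inf_lbound infA.2).
split => /=.
- by apply: closed_inf_mem => // u [].
- by rewrite lb_le_inf//= geA.
- by move=> u Tu tu; exact: geA.
- move=> At d d0; have [u Au] := inf_adherent d0 infA.
  by rewrite At => utd; case: (Au) => Tu tu; exists u; rewrite ?tu.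
Qed.

Lemma is_delta_derivative_normP {H : R -> R} {t D : R} :
  is_delta_derivative T a b H t D <->
  forall e : R, 0 < e -> exists2 d : R, 0 < d & forall s, I s -> `|s - t| < d ->
    `|H (forward_jump T t) - H s - D * (forward_jump T t - s)|
      <= e * `|forward_jump T t - s|.
Proof.
by split => HD e /HD/near_within_normP.
Qed.

(* Induction along the time scale, with slack e (t - a) to absorb the error
   in the definition of the derivative. *)
Lemma delta_antiderivative_le {f H : R -> R} :
  delta_antiderivative T a b f H ->
  (forall t, I t -> 0 <= f t) -> H a <= H b.
Proof.
move=> [/within_continuous_normP cH dH] f0.
suff slack (e : R) : 0 < e -> H a - e * (b - a) <= H b.
  rewrite leNgt; apply/negP => Hba.
  have ba0 : 0 < b - a by rewrite subr_gt0.
  (* With this value the total slack is half of the supposed drop from [H a] to [H b]. *)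
  have /slack : 0 < (H a - H b) / (2 * (b - a)).
    by rewrite divr_gt0 ?mulr_gt0//; lra.
  have -> : (H a - H b) / (2 * (b - a)) * (b - a) = (H a - H b) / 2.
    by field; lra.
  lra.
move=> e0; pose P s := H a - e * (s - a) <= H s.
pose S := [set t | I t /\ forall s, I s -> s <= t -> P s].
have Sa : S a.
  split; first exact: ts_interval_left.
  move=> s [_ /andP[as_ _]] sa; have -> : s = a by lra.
  by rewrite /P; lra.
have supS : has_sup S.
  by split; [exists a|exists b => s [[_ /andP[]]]].
set m := sup S.
have leSm s : S s -> s <= m by exact: sup_upper_bound.
have Im : I m by apply: (closed_sup_mem ts_interval_closed) => // s [].
have am : a <= m by exact: leSm.
have mb : m <= b by case: Im => _ /andP[].
have Pltm s : I s -> s < m -> P s.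
  move=> Is sm; have ms0 : 0 < m - s by lra.
  have [u [Iu Pu]] := sup_adherent ms0 supS.
  by rewrite -/m => su; apply: Pu => //; lra.
have Pm : P m.
  rewrite /P leNgt; apply/negP => Hm.
  (* [P] passes to the supremum: the failure gap serves as tolerance for continuity at [m], which
     contradicts [P u] at a point [u] of [S] close to [m]. *)
  have gap0 : 0 < H a - e * (m - a) - H m by lra.
  have [d d0 Hd] := cH m Im _ gap0.
  have [u Su] := sup_adherent d0 supS; rewrite -/m => mdu.
  have um := leSm u Su; case: Su => Iu /(_ u Iu (lexx u)) Pu.
  have /Hd : `|u - m| < d by rewrite ltr_distl; lra.
  move=> /(_ Iu); rewrite ltr_distl => /andP[_].
  have : 0 <= e * (m - u) by rewrite mulr_ge0//; lra.
  by move: Pu; rewrite /P; lra.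
have Plem s : I s -> s <= m -> P s.
  by move=> Is; rewrite le_eqVlt => /predU1P[->//|]; exact: Pltm.
move: (mb); rewrite le_eqVlt => /predU1P[mb'|ltmb].
  by rewrite -mb'; exact: Pm.
have [] := forward_jump_spec ltmb.
have /is_delta_derivative_normP/(_ e e0)[d d0] := dH m Im ltmb.
set o := forward_jump T m => Hd To /andP[mo ob] jump dense.
have fm0 := f0 m Im.
(* If [m < b], then [S] has a point beyond [m], contradicting the supremum. At a right-dense [m],
   the derivative estimate gives [P] on a whole right neighborhood. *)
move: (mo); rewrite le_eqVlt => /predU1P[mo'|ltmo].
  have md0 : 0 < Num.min d (b - m) by rewrite lt_min d0; lra.
  have [u Tu /andP[mu]] := dense (esym mo') _ md0.
  rewrite -ltrBlDl lt_min => /andP[umd umb].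
  have Iu : I u by split=> //; lra.
  suff /leSm : S u by lra.
  split=> // s Is su; have [sm|ms] := leP s m; first exact: Plem.
  have /Hd : `|s - m| < d by rewrite ltr_distl; lra.
  rewrite -mo' (distrC m s) (gtr0_norm (_ : 0 < s - m)); last by lra.
  move=> /(_ Is); rewrite ler_norml => /andP[_].
  have : 0 <= f m * (s - m) by rewrite mulr_ge0//; lra.
  by move: Pm; rewrite /P; lra.
(* At a right-scattered [m] the new point is [o]: no point of [T] lies strictly between, and the
   derivative estimate at [s = m] controls [H o - H m]. *)
have Io : I o by split=> //; lra.
suff /leSm : S o by lra.
split=> // s [Ts ?] so; have [sm|ms] := leP s m; first by apply: Plem.
have -> : s = o by apply/le_anti; rewrite so jump.
have /Hd : `|m - m| < d by rewrite subrr normr0.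
rewrite (gtr0_norm (_ : 0 < o - m)); last by lra.
move=> /(_ Im); rewrite ler_norml => /andP[+ _].
have : 0 <= f m * (o - m) by rewrite mulr_ge0//; lra.
by move: Pm; rewrite /P; lra.
Qed.

End time_scale_interval.

(** * Linearity of antiderivatives and uniqueness of the delta integral *)

Section delta_antiderivatives.
Context {R : realType} {T : set R} {a b : R}.
Local Notation I := (ts_interval T a b).

Lemma delta_antiderivative_cst (k : R) :
  delta_antiderivative T a b (fun=> k) (fun t => k * t).
Proof.
split.
  apply: continuous_subspaceT => t; apply: cvgM; [exact: cvg_cst|exact: cvg_id].
move=> t _ _; apply/is_delta_derivative_normP => e e0; exists 1 => // s _ _.
by rewrite -mulrBr subrr normr0 mulr_ge0// ltW.
Qed.

Lemma delta_antiderivativeDZ (k : R) {f1 f2 H1 H2 : R -> R} :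
  delta_antiderivative T a b f1 H1 -> delta_antiderivative T a b f2 H2 ->
  delta_antiderivative T a b (fun t => f1 t + k * f2 t)
    (fun t => H1 t + k * H2 t).
Proof.
move=> [cH1 dH1] [cH2 dH2]; split.
  move=> t; apply: cvgD; first exact: cH1.
  by apply: cvgM; [exact: cvg_cst|exact: cH2].
move=> t It tb; apply/is_delta_derivative_normP => e e0.
have k1 : 0 < 1 + `|k| by rewrite ltr_pwDl.
(* The two errors enter with weights 1 and [|k|], so this tolerance makes them add up to [e]. *)
have e1 : 0 < e / (1 + `|k|) by rewrite divr_gt0.
have /is_delta_derivative_normP/(_ _ e1)[d1 d10 D1] := dH1 t It tb.
have /is_delta_derivative_normP/(_ _ e1)[d2 d20 D2] := dH2 t It tb.
exists (Num.min d1 d2); first by rewrite lt_min d10.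
move=> s Is; rewrite lt_min => /andP[/(D1 _ Is) le1 /(D2 _ Is) le2].
set o := forward_jump T t in le1 le2 *.
rewrite (_ : _ - _ - _ = (H1 o - H1 s - f1 t * (o - s))
    + k * (H2 o - H2 s - f2 t * (o - s))); last by ring.
rewrite (le_trans (ler_normD _ _))// normrM.
have -> : e * `|o - s| = e / (1 + `|k|) * `|o - s|
    + `|k| * (e / (1 + `|k|) * `|o - s|) by field; rewrite gt_eqF.
by rewrite lerD// ler_wpM2l.
Qed.

Hypotheses (closedT : closed T) (Ta : T a) (Tb : T b) (ltab : a < b).

Lemma le_delta_antiderivative {f1 f2 H1 H2 : R -> R} :
  delta_antiderivative T a b f1 H1 -> delta_antiderivative T a b f2 H2 ->
  (forall t, I t -> f1 t <= f2 t) -> H1 b - H1 a <= H2 b - H2 a.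
Proof.
move=> D1 D2 f12.
have f12_ge0 t : I t -> 0 <= f2 t + - 1 * f1 t by move=> /f12; lra.
have := delta_antiderivative_le closedT Ta Tb ltab
  (delta_antiderivativeDZ (- 1) D2 D1) f12_ge0.
by lra.
Qed.

(** Comparing two antiderivatives of [f] in both directions gives them equal increments, so [xget]
    chooses from a singleton. *)
Lemma delta_integralE {f H : R -> R} : delta_antiderivative T a b f H ->
  delta_integral T a b f = H b - H a.
Proof.
move=> fH; rewrite /delta_integral; apply: xget_unique.
  by exists H.
move=> _ [H' fH' ->]; apply/le_anti.
by rewrite !(le_delta_antiderivative fH fH', le_delta_antiderivative fH' fH).
Qed.

End delta_antiderivatives.

(** * Existence of delta antiderivatives by Lebesgue integration *)

Section delta_antiderivative_existence.
Context {R : realType} {T : set R} {a b : R}.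
Hypotheses (closedT : closed T) (Ta : T a) (Tb : T b) (ltab : a < b).
Local Notation I := (ts_interval T a b).
Local Notation mu := (@lebesgue_measure R).

(* The last point of the time scale before x. Truncation by a makes it
   monotone, hence measurable, on the whole line. *)
Let last_point (x : R) : R := sup [set s | I s /\ s <= Num.max a x].

Let has_sup_last_point x : has_sup [set s | I s /\ s <= Num.max a x].
Proof.
split; last by exists b => s [[_ /andP[]]].
by exists a; split; [exact: ts_interval_left|rewrite le_max lexx].
Qed.

Let last_point_mem x : I (last_point x).
Proof.
apply: (closed_sup_mem (ts_interval_closed closedT)) _ (has_sup_last_point x).
by move=> s [].
Qed.

Let last_point_homo : {homo last_point : x y / x <= y}.
Proof.
move=> x y xy; apply: ge_sup; first by have [] := has_sup_last_point x.
move=> s [Is sx]; apply: sup_upper_bound => //; split=> //.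
by rewrite (le_trans sx)// ge_max le_max lexx le_max xy orbT.
Qed.

Let last_point_itv s t x : I s -> s < x < t -> s <= last_point x < t.
Proof.
move=> Is /andP[sx xt]; have as_ : a <= s by case: Is => _ /andP[].
have ax : a <= x by lra.
apply/andP; split.
  by apply: sup_upper_bound => //; split=> //; rewrite le_max (ltW sx) orbT.
apply: le_lt_trans xt; apply: ge_sup; first by have [] := has_sup_last_point x.
by move=> u [_]; rewrite max_r.
Qed.

Variable f : R -> R.
Hypothesis cf : {within I, continuous f}.

Let interval_bound : exists2 M : R, 0 <= M & forall t, I t -> `|f t| <= M.
Proof.
have I0 : I !=set0 by exists a; exact: ts_interval_left.
have cI := ts_interval_compact closedT : compact I.
have cnf : {within I, continuous (fun t => `|f t|)}.
  by move=> t; apply: cvg_norm; exact: cf.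
have [c _ fc] := compact_EVT_max I0 cI cnf.
by exists `|f c| => // t It; apply: fc; rewrite inE.
Qed.

(** Continuity of [f] is known only on [I]; this suffices because [last_point] is monotone with
    values in [I]. *)
Let measurable_step : measurable_fun setT (f \o last_point).
Proof.
apply: (@measurable_comp _ _ _ _ _ _ I).
- by apply: closed_measurable; exact: ts_interval_closed.
- by move=> _ [x _ <-].
- apply: subspace_continuous_measurable_fun => //.
  by apply: closed_measurable; exact: ts_interval_closed.
- exact: nondecreasing_measurable.
Qed.

Let integrable_step (D : set R) : measurable D -> (mu D < +oo)%E ->
  mu.-integrable D (EFin \o (f \o last_point)).
Proof.
move=> mD muD; have [M M0 fM] := interval_bound.
apply: measurable_bounded_integrable => //.
  exact: measurable_funS measurable_step.
exists M; split; first exact: num_real.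
by move=> x Mx y _ /=; rewrite (le_trans _ (ltW Mx))// fM.
Qed.

Let measure_itv_lty (i j : bool) (x y : R) :
  (mu [set` Interval (BSide i x) (BSide j y)] < +oo)%E.
Proof.
by rewrite lebesgue_measure_itv/=; case: ifP => // _; rewrite ltry.
Qed.

Let H (t : R) : R := \int[mu]_(x in `[a, t]) f (last_point x).

(** The key estimate, giving both continuity ([y = 0]) and the derivative ([y] a value of [f]). For
    [x] in []s, t[] the last point lies in [[s, t[], so the integrand is within [e] of [y]. *)
Let H_increment (s t y e : R) : I s -> s <= t ->
  (forall u, I u -> s <= u < t -> `|f u - y| <= e) ->
  `|H t - H s - y * (t - s)| <= e * (t - s).
Proof.
move=> Is st fy; have as_ : a <= s by case: Is => _ /andP[].
(* The right endpoint, a null set, is dropped since the last point could equal [t] there. *)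
have -> : H t - H s = \int[mu]_(x in `]s, t[) f (last_point x).
  rewrite /H Rintegral_itvB//.
    by rewrite -Rintegral_itv_bndo_bndc//; exact: integrable_step.
  exact: integrable_step.
have mst : fine (mu `]s, t[) = t - s.
  rewrite lebesgue_measure_itv/= lte_fin.
  by case: ltP => // ts; apply/esym/eqP; rewrite subr_eq0 eq_le st ts.
have icst k : mu.-integrable `]s, t[ (EFin \o (fun=> k)).
  apply: measurable_bounded_integrable => //; first exact: measure_itv_lty.
  by exists `|k|; split=> [|x kx u _ /=]; [exact: num_real|exact: ltW].
have idiff k : mu.-integrable `]s, t[ (EFin \o (fun x => f (last_point x) - k)).
  have istep := integrable_step _ (measurable_itv `]s, t[)
    (measure_itv_lty _ _ _ _).
  exact: integrableB istep (icst k).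
rewrite -mst -!Rintegral_cst// -RintegralB//; last exact: integrable_step.
rewrite (le_trans (le_normr_Rintegral _ _))//.
apply: le_Rintegral => //; first exact: integrable_norm.
move=> x; rewrite /= in_itv/= => sxt; apply: fy => //; exact: last_point_itv.
Qed.

Lemma delta_antiderivative_exists : exists H, delta_antiderivative T a b f H.
Proof.
exists H; split.
  have [M M0 fM] := interval_bound.
  have HM s t : I s -> s <= t -> `|H t - H s| <= M * (t - s).
    move=> Is st; have := @H_increment s t 0 M Is st.
    by rewrite mul0r subr0; apply => u Iu _; rewrite subr0 fM.
  apply/within_continuous_normP => t It e e0.
  have M1 : 0 < M + 1 by lra.
  exists (e / (M + 1)); first by rewrite divr_gt0.
  move=> s Is; rewrite ltr_pdivlMr// => ste.
  have le_dist : `|H s - H t| <= M * `|s - t|.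
    have [st|/ltW ts] := leP s t; last first.
      by rewrite (ger0_norm (_ : 0 <= s - t)) ?subr_ge0// HM.
    by rewrite distrC (distrC s) (ger0_norm (_ : 0 <= t - s)) ?subr_ge0// HM.
  rewrite (le_lt_trans le_dist)// (le_lt_trans _ ste)//.
  by rewrite mulrC ler_wpM2l//; lra.
move=> t It tb; apply/is_delta_derivative_normP => e e0.
have [d d0 fd] := within_continuous_normP.1 cf t It e e0.
have [] := forward_jump_spec closedT Tb tb.
set o := forward_jump T t => To /andP[to ob] jump _.
(* At a right-scattered [t], the radius [o - t] excludes every point of [I] to the right of [t], as
   such points are at least [o]. *)
exists (if o == t then d else Num.min d (o - t)).
  by case: eqVneq => // ot; rewrite lt_min d0 subr_gt0 lt_neqAle eq_sym ot.
move=> s Is std.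
have {std} [std so] : `|s - t| < d /\ (t < s -> o = t).
  move: std; case: eqVneq => [//|ot]; rewrite lt_min => /andP[-> sto].
  split=> // ts; have := jump s Is.1 ts; move: sto; rewrite ltr_distl; lra.
(* For [s <= t], points of [I] in [[s, o[] cannot exceed [t], so they remain within [d] of [t] even
   if [o] is far away. For [t < s], necessarily [o = t], and the increment runs from [t] to [s]. *)
have [st|ts] := leP s t.
  rewrite (ger0_norm (_ : 0 <= o - s)); last by lra.
  apply: H_increment => //; first by lra.
  move=> u Iu /andP[su uo]; apply/ltW/fd => //.
  have ut : u <= t by rewrite leNgt; apply/negP => /(jump u Iu.1); lra.
  by move: std; rewrite !ltr_distl; lra.
rewrite so// (distrC t) (ger0_norm (_ : 0 <= s - t)); last by lra.
have -> : H t - H s - f t * (t - s) = - (H s - H t - f t * (s - t)) by ring.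
rewrite normrN.
apply: H_increment => //; first exact: ltW.
move=> u Iu /andP[tu us]; apply/ltW/fd => //.
by move: std; rewrite !ltr_distl; lra.
Qed.

End delta_antiderivative_existence.

(** * Monotonicity and affinity of the delta integral *)

Section delta_integral_theory.
Context {R : realType} {T : set R} {a b : R}.
Hypotheses (closedT : closed T) (Ta : T a) (Tb : T b) (ltab : a < b).
Local Notation I := (ts_interval T a b).

Lemma le_delta_integral {f1 f2 : R -> R} :
  {within I, continuous f1} -> {within I, continuous f2} ->
  (forall t, I t -> f1 t <= f2 t) ->
  delta_integral T a b f1 <= delta_integral T a b f2.
Proof.
move=> cf1 cf2 f12.
have [H1 D1] := delta_antiderivative_exists closedT Ta Tb ltab f1 cf1.
have [H2 D2] := delta_antiderivative_exists closedT Ta Tb ltab f2 cf2.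
rewrite (delta_integralE closedT Ta Tb ltab D1).
rewrite (delta_integralE closedT Ta Tb ltab D2).
exact: (le_delta_antiderivative closedT Ta Tb ltab D1 D2).
Qed.

Lemma delta_integral_affine (l k : R) {f : R -> R} :
  {within I, continuous f} ->
  delta_integral T a b (fun t => l + k * f t) =
  l * (b - a) + k * delta_integral T a b f.
Proof.
move=> cf; have [H D] := delta_antiderivative_exists closedT Ta Tb ltab f cf.
rewrite (delta_integralE closedT Ta Tb ltab D).
rewrite (delta_integralE closedT Ta Tb ltab
  (delta_antiderivativeDZ k (delta_antiderivative_cst l) D)).
by ring.
Qed.

End delta_integral_theory.

(** * Reflection of the time scale, exchanging delta and nabla *)

Section reflection.
Context {R : realType} {T : set R} {a b : R}.
Local Notation I := (ts_interval T a b).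
Local Notation NT := [set t | T (- t)].
Local Notation NI := (ts_interval NT (- b) (- a)).

Lemma ts_intervalN (t : R) : NI t <-> I (- t).
Proof. by rewrite /ts_interval/= lerNl lerNr andbC. Qed.

Lemma forward_jumpN (t : R) : forward_jump NT (- t) = - backward_jump T t.
Proof.
have imN (A B : set R) : (forall s, A s <-> B (- s)) -> -%R @` A = B.
  move=> AB; apply/seteqP; split=> [_ [s /AB ? <-]//|s Bs].
  by exists (- s); rewrite ?opprK//; apply/AB; rewrite opprK.
have AB : -%R @` [set s | NT s /\ - t < s] = [set s | T s /\ s < t].
  by apply: imN => s /=; rewrite ltrNl.
have infA : inf [set s | NT s /\ - t < s] = - sup [set s | T s /\ s < t].
  by rewrite /inf AB.
rewrite /forward_jump /backward_jump.
case: pselect => [[s As]|A0]; case: pselect => [B0|B0].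
- exact: infA.
- by case: B0; exists (- s); rewrite -AB; exists s.
- by case: A0; case: B0 => s; rewrite -AB => -[u Au _]; exists u.
(* When both sets are empty the conventions also correspond under reflection: the supremum of [NT]
   is minus the infimum of [T]. *)
- by rewrite /inf opprK; congr sup; apply/esym/imN => s /=; rewrite opprK.
Qed.

Lemma within_continuousN {f : R -> R} : {within I, continuous f} ->
  {within NI, continuous (fun t => f (- t))}.
Proof.
move=> /within_continuous_normP cf; apply/within_continuous_normP.
move=> t /ts_intervalN It e e0; have [d d0 fd] := cf _ It e e0.
exists d => // s /ts_intervalN Is std; apply: fd => //.
by rewrite -opprD normrN.
Qed.

End reflection.

Section nabla_integral_reflection.
Context {R : realType}.
Implicit Types (T : set R) (f G H : R -> R).

(** The sign from reflecting the argument cancels the sign put in front of [G], so the derivative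
    [D] is unchanged. *)
Lemma is_nabla_derivativeN T a b G t D :
  is_nabla_derivative T a b G t D <->
  is_delta_derivative [set t | T (- t)] (- b) (- a)
    (fun t => - G (- t)) (- t) D.
Proof.
have flip (s : R) : `|- G (- forward_jump [set t | T (- t)] (- t)) - - G (- s) -
      D * (forward_jump [set t | T (- t)] (- t) - s)| =
    `|G (backward_jump T t) - G (- s) - D * (backward_jump T t - - s)|.
  rewrite forward_jumpN opprK -normrN; congr Num.norm; ring.
have flip0 (s : R) : `|forward_jump [set t | T (- t)] (- t) - s| =
    `|backward_jump T t - - s|.
  by rewrite forward_jumpN -normrN; congr Num.norm; ring.
split=> GD e /GD/near_within_normP[d d0 Gd]; apply/near_within_normP;
    exists d => // s Is std.
  rewrite flip flip0; apply: Gd; first exact/ts_intervalN.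
  by rewrite -normrN opprD opprK.
have := Gd (- s); rewrite flip flip0 !opprK; apply.
  by apply/ts_intervalN; rewrite opprK.
by rewrite -normrN opprD opprK.
Qed.

Lemma nabla_antiderivativeN T a b f G :
  nabla_antiderivative T a b f G <->
  delta_antiderivative [set t | T (- t)] (- b) (- a)
    (fun t => f (- t)) (fun t => - G (- t)).
Proof.
split=> -[cG dG]; split.
- by move=> t; apply: cvgN; exact: (within_continuousN cG).
- move=> t /ts_intervalN It; rewrite ltrNr => ta.
  by have /is_nabla_derivativeN := dG _ It ta; rewrite opprK.
- move: cG => /within_continuous_normP cG; apply/within_continuous_normP.
  move=> t It e e0; have [|d d0 Gd] := cG (- t) _ e e0.
    by apply/ts_intervalN; rewrite opprK.
  exists d => // s Is std; have := Gd (- s); rewrite !opprK.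
  rewrite -(normrN (G s - G t)) -(normrN (s - t)) !opprD !opprK in std *.
  by apply=> //; apply/ts_intervalN; rewrite opprK.
- move=> t It ta; apply/is_nabla_derivativeN.
  rewrite -[in f t](opprK t); apply: dG; last by rewrite ltrN2.
  by apply/ts_intervalN; rewrite opprK.
Qed.

(** The sets of admissible values coincide, so both [xget] agree for every [f], whether or not an
    antiderivative exists. *)
Lemma nabla_integralN T a b f : nabla_integral T a b f =
  delta_integral [set t | T (- t)] (- b) (- a) (fun t => f (- t)).
Proof.
rewrite /nabla_integral /delta_integral; congr xget.
apply/seteqP; split=> [_ [G /nabla_antiderivativeN fG ->]|_ [H fH ->]].
  by exists (fun t => - G (- t)) => //; rewrite !opprK addrC.
exists (fun t => - H (- t)); last by rewrite opprK addrC.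
apply/nabla_antiderivativeN; congr (delta_antiderivative _ _ _ _ _) : fH.
by apply/funext => t; rewrite !opprK.
Qed.

End nabla_integral_reflection.

(** * Chords, supporting lines and continuity of convex functions *)

Section convex_function_theory.
Context {R : realType} {c d : R} {F : R -> R}.
Hypothesis hF : convex_function (`]c, d[%classic : set R) F.

Lemma convex_function_chord (x m y : R) : c < x -> x < m -> m < y -> y < d ->
  (y - x) * F m <= (y - m) * F x + (m - x) * F y.
Proof.
move=> cx xm my yd.
have yx0 : 0 < y - x by lra.
(* The weight of [x] in the convex combination of [x] and [y] equal to [m]. *)
pose s := (y - m) / (y - x).
have s0 : 0 <= s by rewrite divr_ge0//; lra.
have s1 : s <= 1 by rewrite ler_pdivrMr//; lra.
have xD : x \in (`]c, d[%classic : set R) by rewrite inE/= in_itv/=; lra.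
have yD : y \in (`]c, d[%classic : set R) by rewrite inE/= in_itv/=; lra.
have : F (s * x + (1 - s) * y) <= s * F x + (1 - s) * F y :=
  hF (Itv01 s0 s1) x y xD yD.
have -> : s * x + (1 - s) * y = m by rewrite /s; field; lra.
have -> : s * F x + (1 - s) * F y =
    ((y - m) * F x + (m - x) * F y) / (y - x) by rewrite /s; field; lra.
by rewrite ler_pdivlMr// mulrC.
Qed.

(** The chord inequality puts every slope on the left of [m] below every slope on its right; [k] is
    the supremum of the left slopes. *)
Lemma convex_function_support_line (m : R) : c < m < d ->
  exists k : R, forall y, c < y < d -> F m + k * (y - m) <= F y.
Proof.
move=> /andP[cm md].
pose slope x := (F m - F x) / (m - x).
pose S := [set slope x | x in [set x | c < x < m]].
have leS x y : c < x -> x < m -> m < y -> y < d ->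
    slope x <= (F y - F m) / (y - m).
  move=> cx xm my yd; have := convex_function_chord x m y cx xm my yd.
  rewrite /slope ler_pdivrMr ?subr_gt0// mulrAC ler_pdivlMr ?subr_gt0//.
  lra.
have S0 : S !=set0.
  by exists (slope ((c + m) / 2)); exists ((c + m) / 2) => //=; lra.
have supS : has_sup S.
  split=> //; exists ((F ((m + d) / 2) - F m) / ((m + d) / 2 - m)).
  by move=> _ [x /= /andP[cx xm] <-]; apply: leS => //; lra.
exists (sup S) => y /andP[cy yd]; have [ym|my|->] := ltgtP y m.
- have : slope y <= sup S.
    by apply: sup_upper_bound => //; exists y => //=; rewrite cy.
  by rewrite /slope ler_pdivrMr ?subr_gt0//; lra.
- have : sup S <= (F y - F m) / (y - m).
    by apply: ge_sup => // _ [x /= /andP[cx xm] <-]; exact: leS.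
  by rewrite ler_pdivlMr ?subr_gt0//; lra.
- by lra.
Qed.

(** Near [x], the graph lies above a supporting line and below the chords from [x] to [p] and [q],
    which gives a Lipschitz estimate at [x]. *)
Lemma convex_function_continuous (x : R) : c < x < d -> {for x, continuous F}.
Proof.
move=> cxd; have [k Fk] := convex_function_support_line x cxd.
move: (cxd) => /andP[cx xd].
pose p := (c + x) / 2; pose q := (x + d) / 2.
have cp : c < p by rewrite /p; lra.
have px : p < x by rewrite /p; lra.
have xq : x < q by rewrite /q; lra.
have qd : q < d by rewrite /q; lra.
pose sp := (F x - F p) / (x - p); pose sq := (F q - F x) / (q - x).
(* The sum dominates all three slopes, and the added 1 permits division by [L]. *)
pose L : R := `|k| + `|sp| + `|sq| + 1.
have L0 : 0 < L by rewrite ltr_wpDl// !addr_ge0.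
have lipschitz y : p < y < q -> `|F x - F y| <= L * `|x - y|.
  move=> /andP[py yq].
  have := Fk y; rewrite (lt_trans cp py) (lt_trans yq qd) => /(_ isT) Fky.
  have leM (r : R) : r * `|x - y| <= `|r| * `|x - y|.
    by rewrite ler_wpM2r ?ler_norm.
  have M0 (r : R) : 0 <= `|r| * `|x - y| by rewrite mulr_ge0.
  have Lxy : `|k| * `|x - y| + `|sp| * `|x - y| + `|sq| * `|x - y|
      <= L * `|x - y|.
    by rewrite /L !mulrDl lerDl mul1r.
  have [leMk leMNk] := (leM k, leM (- k)); rewrite normrN in leMNk.
  have [M0k M0sp M0sq] := And3 (M0 k) (M0 sp) (M0 sq).
  have [leMsp leMsq] := (leM (- sp), leM sq); rewrite normrN in leMsp.
  have [yx|xy|<-] := ltgtP y x.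
  - have Fy : F y <= F x + - sp * (x - y).
      have := convex_function_chord p y x cp py yx xd.
      rewrite -ler_pdivlMl ?subr_gt0// => /le_trans; apply.
      by rewrite le_eqVlt; apply/orP; left; apply/eqP; rewrite /sp; field; lra.
    move: Lxy M0k M0sp M0sq leMk leMNk leMsp leMsq.
    rewrite (gtr0_norm (_ : 0 < x - y)) ?subr_gt0// ler_norml; lra.
  - have Fy : F y <= F x + sq * (y - x).
      have := convex_function_chord x y q cx xy yq qd.
      rewrite -ler_pdivlMl ?subr_gt0// => /le_trans; apply.
      by rewrite le_eqVlt; apply/orP; left; apply/eqP; rewrite /sq; field; lra.
    move: Lxy M0k M0sp M0sq leMk leMNk leMsp leMsq.
    rewrite (distrC x) (gtr0_norm (_ : 0 < y - x)) ?subr_gt0// ler_norml; lra.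
  - by rewrite !subrr normr0 mulr0.
apply/cvgrPdist_lt => e e0; apply/nbhs_ballP.
exists (Num.min (e / L) (Num.min (x - p) (q - x))) => /=.
  by rewrite !lt_min divr_gt0//= !subr_gt0 px.
move=> y /=; rewrite !lt_min ltr_pdivlMr// mulrC.
move=> /and3P[xye xyp xyq]; apply: le_lt_trans xye; apply: lipschitz.
by move: xyp xyq; rewrite !ltr_distlC; lra.
Qed.

End convex_function_theory.

(** * The diamond integral and the location of the mean *)

Section diamond_integral_theory.
Context {R : realType} {T : set R} {alpha a b : R}.
Hypotheses (closedT : closed T) (Ta : T a) (Tb : T b) (ltab : a < b).
Hypothesis alpha01 : 0 <= alpha <= 1.
Local Notation I := (ts_interval T a b).
Local Notation NT := [set t | T (- t)].

Let closedNT : closed NT.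
Proof. by apply: closed_comp => // t _; exact: opp_continuous. Qed.

Let NTa : NT (- a). Proof. by rewrite /= opprK. Qed.
Let NTb : NT (- b). Proof. by rewrite /= opprK. Qed.
Let ltNba : - b < - a. Proof. by rewrite ltrN2. Qed.

Lemma le_diamond_integral {f1 f2 : R -> R} :
  {within I, continuous f1} -> {within I, continuous f2} ->
  (forall t, I t -> f1 t <= f2 t) ->
  diamond_integral T alpha a b f1 <= diamond_integral T alpha a b f2.
Proof.
move=> cf1 cf2 f12; case/andP: alpha01 => alpha0 alpha1.
rewrite /diamond_integral lerD// ler_wpM2l ?subr_ge0//.
  exact: (le_delta_integral closedT).
rewrite !nabla_integralN; apply: (le_delta_integral closedNT) => //.
- exact: within_continuousN.
- exact: within_continuousN.
- by move=> t /ts_intervalN; exact: f12.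
Qed.

Lemma diamond_integral_affine (l k : R) {f : R -> R} :
  {within I, continuous f} ->
  diamond_integral T alpha a b (fun t => l + k * f t) =
  l * (b - a) + k * diamond_integral T alpha a b f.
Proof.
move=> cf; rewrite /diamond_integral !nabla_integralN.
rewrite (delta_integral_affine closedT Ta Tb ltab _ _ cf).
rewrite (delta_integral_affine closedNT NTb NTa ltNba _ _
  (within_continuousN cf)).
by ring.
Qed.

(** By compactness [f] attains its extrema, so they lie strictly between [c] and [d]. They bound the
    mean by comparison with constants, written [l + 0 * f t] to reuse the affine formula. *)
Lemma diamond_mean_itv {c d : R} {f : R -> R} :
  {within I, continuous f} -> (forall t, I t -> c < f t < d) ->
  c < diamond_integral T alpha a b f / (b - a) < d.
Proof.
move=> cf fcd; have ba0 : 0 < b - a by rewrite subr_gt0.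
have I0 : I !=set0 by exists a; exact: ts_interval_left.
have cI : compact I := ts_interval_compact closedT.
have cE (l : R) : {within I, continuous (fun t => l + 0 * f t)}.
  move=> t; apply: cvgD; first exact: cvg_cst.
  by apply: cvgM; [exact: cvg_cst|exact: cf].
have [u /set_mem Iu fu] := compact_EVT_min I0 cI cf.
have [v /set_mem Iv fv] := compact_EVT_max I0 cI cf.
have lefu : f u <= diamond_integral T alpha a b f / (b - a).
  rewrite ler_pdivlMr//; have := diamond_integral_affine (f u) 0 cf.
  rewrite mul0r addr0 => <-; apply: le_diamond_integral => // t It.
  by rewrite mul0r addr0 fu ?inE.
have lefv : diamond_integral T alpha a b f / (b - a) <= f v.
  rewrite ler_pdivrMr//; have := diamond_integral_affine (f v) 0 cf.
  rewrite mul0r addr0 => <-; apply: le_diamond_integral => // t It.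
  by rewrite mul0r addr0 fv ?inE.
have /andP[cfu _] := fcd u Iu; have /andP[_ fvd] := fcd v Iv.
by rewrite (lt_le_trans cfu lefu) (le_lt_trans lefv fvd).
Qed.

End diamond_integral_theory.

(** * Jensen's inequality *)

Theorem mainTheorem4 (R : realType) (T : set R) (hT : time_scale T)
    (a b : R) (ha : T a) (hb : T b) (hab : a < b)
    (alpha : R) (halpha : 0 <= alpha <= 1)
    (c d : R) (g F : R -> R)
    (hg : {within ts_interval T a b, continuous g})
    (hgcd : forall t, ts_interval T a b t -> c < g t < d)
    (hF : convex_function (`]c, d[%classic : set R) F) :
  F (diamond_integral T alpha a b g / (b - a))
    <= diamond_integral T alpha a b (fun t => F (g t)) / (b - a).
Proof.
case: hT => _ closedT; have ba0 : 0 < b - a by rewrite subr_gt0.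
set m := diamond_integral T alpha a b g / (b - a).
have mcd : c < m < d := diamond_mean_itv closedT ha hb hab halpha hg hgcd.
have [k Fk] := convex_function_support_line hF m mcd.
have cFg : {within ts_interval T a b, continuous (fun t => F (g t))}.
  apply/subspace_continuousP => t It.
  apply: (cvg_comp g F ((subspace_continuousP _ _).1 hg t It)).
  exact: (convex_function_continuous hF _ (hgcd t It)).
(* The supporting line at [m], composed with [g] and put in affine form; its integral is
   [F m * (b - a)] because the linear terms cancel at the mean. *)
have cline : {within ts_interval T a b,
    continuous (fun t => (F m - k * m) + k * g t)}.
  move=> t; apply: cvgD; first exact: cvg_cst.
  by apply: cvgM; [exact: cvg_cst|exact: hg].
have := le_diamond_integral closedT ha hb hab halpha cline cFg.
rewrite (diamond_integral_affine closedT ha hb hab _ _ hg) ler_pdivlMr//.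
have -> : diamond_integral T alpha a b g = m * (b - a).
  by rewrite /m divfK// gt_eqF.
have -> : (F m - k * m) * (b - a) + k * (m * (b - a)) = F m * (b - a) by ring.
apply=> t It; have := Fk (g t) (hgcd t It); lra.
Qed.
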